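(* Let $Z_1^*=X_{a_2}/V_2$, let $\phi_2^*$ be a positive measurable function on $\mathbb{R}$, and let $\delta_{\phi_2^*}=\phi_2^*(Z_1^* )V_2$ be the corresponding estimator of $\sigma_2$. Let $W\sim \mathrm{Gamma}(b_2-a_2+2,1)$ and let $\beta_1^*$ be the unique solution of $E L'(W\beta_1^* )=0$. For $z>0$ define $$\phi_{22}(z)=\min\{\phi_2^*(z),\ \beta_1^*(1+(n_2-a_2+1)z)\}.$$ Then the estimator $$\delta_{\phi_{22}}=\begin{cases}\phi_{22}(Z_1^* )V_2, & Z_1^*>0,\\ \phi_2^*(Z_1^* )V_2, & \text{otherwise,}\end{cases}$$ dominates $\delta_{\phi_2^*}$ with respect to the scale invariant loss $L$, provided that the event $\{Z_1^*>0,\ \phi_2^*(Z_1^* )>\beta_1^*(1+(n_2-a_2+1)Z_1^* )\}$ has nonzero probability.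
   Context: Fix integers $1\le a_i<b_i\le n_i$, $i=1,2$. The unknown parameter is $\theta=(\mu_1,\mu_2,\sigma_1,\sigma_2)$ with $\mu_1,\mu_2\in\mathbb{R}$ and $0<\sigma_1\le\sigma_2$. From a random sample of size $n_i$ from the exponential distribution with density $\sigma_i^{-1}e^{-(x-\mu_i)/\sigma_i}$, $x>\mu_i$, one observes only the order statistics of ranks $a_i,\dots,b_i$ (doubly type-II censored sample). A complete sufficient statistic is $(X_{a_1},X_{a_2},V_1,V_2)$, consisting of four independent random variables, where $X_{a_i}$ has density $$\frac{n_i!}{(a_i-1)!(n_i-a_i)!}\Big[1-e^{-\frac{x-\mu_i}{\sigma_i}}\Big]^{a_i-1}\frac1{\sigma_i}\Big[e^{-\frac{x-\mu_i}{\sigma_i}}\Big]^{n_i-a_i+1},\quad x>\mu_i,$$ and $V_i$ has the gamma distribution with shape $b_i-a_i$ and scale $\sigma_i$. $\mathrm{Gamma}(k,1)$ denotes the gamma distribution with shape $k$ and scale $1$. The loss for estimating $\sigma_2$ by $\delta$ is $L(\delta/\sigma_2)$, where $L$ is differentiable and: (i) $L(t)$ is bowl-shaped with minimum value $0$ attained at $t=1$, decreasing for $t\le1$ and increasing for $t\ge1$; (ii) all integrals involving $L$ are finite and differentiation under the integral sign is permissible. The risk is $R(\theta,\delta)=E_\theta L(\delta/\sigma_2)$. An estimator $\delta$ dominates $\delta'$ if $R(\theta,\delta)\le R(\theta,\delta')$ for all $\theta$, with strict inequality for at least one $\theta$. *)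

(* Defs.v *)
From HB Require Import structures.
From mathcomp Require Import all_boot all_order all_algebra.
From mathcomp Require Import all_classical all_reals all_analysis.
Set Implicit Arguments.
Unset Strict Implicit.
Unset Printing Implicit Defensive.
Import Order.TTheory GRing.Theory Num.Theory.
Import numFieldNormedType.Exports.
Local Open Scope classical_set_scope.
Local Open Scope ring_scope.

Record param (R : realType) := Param {
  mu1 : R ; mu2 : R ; sigma1 : R ; sigma2 : R }.

Definition in_Theta (R : realType) (th : param R) : Prop :=
  0 < sigma1 th <= sigma2 th.

(* Gamma density; k is the shape (intended for k >= 1), s the scale. *)
Definition gamma_pdf (R : realType) (k : nat) (s x : R) : R :=
  if 0 < x then x ^+ k.-1 * expR (- (x / s)) / ((k.-1)`!%:R * s ^+ k) else 0.

(* Density of the a-th order statistic of n exponential(mu, s) variables. *)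
Definition ordstat_pdf (R : realType) (n a : nat) (mu s x : R) : R :=
  if mu < x then
    n`!%:R / ((a.-1)`!%:R * (n - a)`!%:R)
    * (1 - expR (- ((x - mu) / s))) ^+ a.-1
    * s^-1 * expR (- ((x - mu) / s)) ^+ (n - a + 1)
  else 0.

Definition has_density (R : realType) (d : measure_display)
    (T : measurableType d) (P : probability T R) (X : T -> R) (f : R -> R) :
    Prop :=
  forall A : set R, measurable A ->
    P (X @^-1` A) = (\int[lebesgue_measure]_(x in A) (f x)%:E)%E.

(* The sets may be the whole line, so the product rule for all four variables
   contains the one for every subfamily. *)
Definition independent4 (R : realType) (d : measure_display)
    (T : measurableType d) (P : probability T R) (X1 X2 X3 X4 : T -> R) :
    Prop :=
  forall A1 A2 A3 A4 : set R,
    measurable A1 -> measurable A2 -> measurable A3 -> measurable A4 ->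
    P (X1 @^-1` A1 `&` X2 @^-1` A2 `&` X3 @^-1` A3 `&` X4 @^-1` A4) =
    (P (X1 @^-1` A1) * P (X2 @^-1` A2) * P (X3 @^-1` A3) * P (X4 @^-1` A4))%E.

Definition censored_exp_model (R : realType) (n1 a1 b1 n2 a2 b2 : nat)
    (d : measure_display) (T : measurableType d)
    (P : param R -> probability T R) (X1 X2 V1 V2 : T -> R) : Prop :=
  forall th, in_Theta th ->
    [/\ has_density (P th) X1 (ordstat_pdf n1 a1 (mu1 th) (sigma1 th)),
        has_density (P th) X2 (ordstat_pdf n2 a2 (mu2 th) (sigma2 th)),
        has_density (P th) V1 (gamma_pdf (b1 - a1) (sigma1 th)),
        has_density (P th) V2 (gamma_pdf (b2 - a2) (sigma2 th)) &
        independent4 (P th) X1 X2 V1 V2].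

(* Estimators of a positive scale are positive, so only the values of L on
   ]0, +oo[ matter (some losses, e.g. t - ln t - 1, live only there).  The
   first clause constrains nothing but the irrelevant values of L at t <= 0,
   since L is continuous on ]0, +oo[.  Monotonicity is in the weak sense. *)
Definition bowl_loss (R : realType) (L : R -> R) : Prop :=
  [/\ measurable_fun setT L,
      forall t : R, 0 < t -> derivable L t 1,
      L 1 = 0,
      forall s t : R, 0 < s -> s <= t -> t <= 1 -> L t <= L s &
      forall s t : R, 1 <= s -> s <= t -> L s <= L t].

(* Risk for estimating sigma2; it is +oo when the expectation diverges. *)
Definition risk (R : realType) (d : measure_display) (T : measurableType d)
    (P : param R -> probability T R) (L : R -> R) (th : param R)
    (delta : T -> R) : \bar R :=
  ('E_(P th) [fun w => (L (delta w / sigma2 th))%R])%E.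

Definition dominates (R : realType) (d : measure_display)
    (T : measurableType d) (P : param R -> probability T R) (L : R -> R)
    (delta delta' : T -> R) : Prop :=
  (forall th, in_Theta th -> (risk P L th delta <= risk P L th delta')%E) /\
  (exists2 th, in_Theta th & (risk P L th delta < risk P L th delta')%E).

(* E |f(W)| < +oo for W ~ Gamma(k, 1); only f on ]0, +oo[ matters. *)
Definition gamma_integrable (R : realType) (k : nat) (f : R -> R) : Prop :=
  (@lebesgue_measure R).-integrable `]0, +oo[
    (fun w : R => (f w * gamma_pdf k 1 w)%:E).

Definition gamma_mean (R : realType) (k : nat) (f : R -> R) : R :=
  (\int[lebesgue_measure]_(w in `]0, +oo[) (f w * gamma_pdf k 1 w))%R.

(* beta is the unique positive solution of E L'(W beta) = 0, W ~ Gamma(k, 1). *)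
Definition is_unique_root (R : realType) (k : nat) (L : R -> R) (beta : R) :
    Prop :=
  [/\ 0 < beta,
      gamma_mean k (fun w => derive1 L (w * beta)) = 0 &
      forall c, 0 < c -> gamma_mean k (fun w => derive1 L (w * c)) = 0 ->
        c = beta].

(* Joint density of (X_{a2} / V2, V2) at (z, v) for v > 0: as a function of v,
   the conditional density of V2 given X_{a2} / V2 = z up to a constant. *)
Definition ratio_pdf (R : realType) (n2 a2 b2 : nat) (th : param R) (z v : R) :
    R :=
  ordstat_pdf n2 a2 (mu2 th) (sigma2 th) (z * v)
  * gamma_pdf (b2 - a2) (sigma2 th) v * v.

(* The integrals of L(c v) and of v L'(c v) against g are finite, and the
   former may be differentiated in c under the integral sign. *)
Definition diff_under_integral (R : realType) (L g : R -> R) : Prop :=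
  forall c : R, 0 < c ->
    [/\ (@lebesgue_measure R).-integrable `]0, +oo[
          (fun v : R => (L (c * v) * g v)%:E),
        (@lebesgue_measure R).-integrable `]0, +oo[
          (fun v : R => (v * derive1 L (c * v) * g v)%:E) &
        is_derive c 1
          (fun t : R =>
             (\int[lebesgue_measure]_(v in `]0, +oo[) (L (t * v) * g v))%R)
          (\int[lebesgue_measure]_(v in `]0, +oo[)
             (v * derive1 L (c * v) * g v))%R].

(* "All integrals involving L are finite and differentiation under the integral
   sign is permissible", for the integrals that occur: the risk of the given
   estimator, E L'(W c) for W ~ Gamma(b2 - a2 + 2, 1), and the conditional
   expected loss of c V2 given X_{a2} / V2 = z > 0, for every c > 0 (the factor
   1 / sigma2 is absorbed in c).  Finite risk cannot be asked of all estimators: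
   for unbounded L that is never satisfied. *)
Definition regular_loss (R : realType) (n2 a2 b2 : nat)
    (d : measure_display) (T : measurableType d)
    (P : param R -> probability T R) (L : R -> R) (delta : T -> R) : Prop :=
  [/\ forall th, in_Theta th ->
        (P th).-integrable setT (fun w => (L (delta w / sigma2 th))%:E),
      forall c, 0 < c ->
        gamma_integrable (b2 - a2 + 2) (fun w => derive1 L (w * c)) &
      forall th z, in_Theta th -> 0 < z ->
        diff_under_integral L (ratio_pdf n2 a2 b2 th z)].

Definition est (R : realType) (T : Type) (phi : R -> R) (X V : T -> R) :
    T -> R :=
  fun w => phi (X w / V w) * V w.

Definition threshold (R : realType) (n2 a2 : nat) (beta z : R) : R :=
  beta * (1 + (n2 - a2 + 1)%:R * z).

Definition phi22 (R : realType) (n2 a2 : nat) (beta : R) (phi : R -> R)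
    (z : R) : R :=
  Num.min (phi z) (threshold n2 a2 beta z).

Definition est22 (R : realType) (T : Type) (n2 a2 : nat) (beta : R)
    (phi : R -> R) (X V : T -> R) : T -> R :=
  fun w => if 0 < X w / V w
           then phi22 n2 a2 beta phi (X w / V w) * V w
           else phi (X w / V w) * V w.

(* Main.v *)
Require Import Defs.
From mathcomp Require Import all_boot all_order all_algebra.
From mathcomp Require Import all_classical all_reals all_analysis.
From mathcomp Require Import measurable_realfun ring.
Import Order.TTheory GRing.Theory Num.Theory.
Import numFieldNormedType.Exports.
Local Open Scope classical_set_scope.
Local Open Scope ring_scope.

(** Write [sigma = sigma2], [mu = mu2], [N = n2 - a2 + 1], [k = b2 - a2].  For
    [z > 0] the joint density of [(X2 / V2, V2)] at [(z, v)] is, up to a positive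
    constant, [m(v) v^k e^{-v (1 + N z) / sigma}], where the factor [m], the only
    one involving the location [mu] and [v] jointly, is nondecreasing in [v].
    Conditionally on [X2 / V2 = z] the expected loss of [sigma c V2] therefore has
    a derivative in [c] proportional to
    [int L'(u) m(u / c) u^{k+1} e^{-s u} du], with [s = (1 + N z) / (sigma c)].
    As [L'] changes sign from - to + at [1] and [m] is nondecreasing, replacing
    [m(u / c)] by the constant [m(1 / c)] only decreases this integral; and by the
    same argument applied to [e^{-s u} / e^{-u / beta}] the integral
    [int L'(u) u^{k+1} e^{-s u} du] is positive as soon as [s < 1 / beta], i.e.
    [sigma c > beta (1 + N z)], since it vanishes exactly for [s = 1 / beta].
    So the conditional expected loss is nondecreasing in [c] above the threshold
    [beta (1 + N z) / sigma], and truncating there does not increase the risk. *)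

(** * Integration against densities and the law of the ratio *)

Lemma ge0_integral_density (R : realType) (d : measure_display)
    (T : measurableType d) (nu : {finite_measure set T -> \bar R})
    (mu : {sigma_finite_measure set T -> \bar R}) (f : T -> R)
    (g : T -> \bar R) :
  measurable_fun setT f -> (forall x, 0 <= f x) ->
  (forall A, measurable A -> nu A = \int[mu]_(x in A) (f x)%:E)%E ->
  measurable_fun setT g -> (forall x, 0 <= g x)%E ->
  (\int[nu]_x g x = \int[mu]_x (g x * (f x)%:E))%E.
Proof.
move=> mf f0 nuE mg g0.
have mfE : measurable_fun setT (EFin \o f) by exact/measurable_EFinP.
have numu : nu `<< mu.
  apply/null_content_dominatesP => A mA muA0; rewrite nuE//.
  apply: null_set_integral => //; exact: measurable_funTS.
have intf : mu.-integrable setT (EFin \o f).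
  apply/integrableP; split => //.
  under eq_integral do rewrite /= ger0_norm//.
  by rewrite -nuE//; exact: fin_num_fun_lty.
(* The chosen Radon-Nikodym derivative need not be [f] itself, but both have the same integral over
   every measurable set, hence agree almost everywhere. *)
rewrite -(Radon_Nikodym_SigmaFinite.change_of_variables numu)//.
apply: ae_eq_integral => //.
- apply: emeasurable_funM => //.
  exact: measurable_int (Radon_Nikodym_SigmaFinite.f_integrable numu).
- exact: emeasurable_funM.
- apply: ae_eqe_mul2l; apply/ae_eq_sym; apply: integral_ae_eq => //.
  + exact: measurable_int (Radon_Nikodym_SigmaFinite.f_integrable numu).
  + move=> A _ mA; rewrite -nuE//.
    exact: Radon_Nikodym_SigmaFinite.f_integral.
Qed.

(** Lebesgue measure is [c] times its pushforward under multiplication by [c]; by uniqueness this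
    need only be checked on intervals. *)
Lemma ge0_integral_scale (R : realType) (c : R) (f : R -> \bar R) :
  0 < c -> measurable_fun setT f -> (forall x, 0 <= f x)%E ->
  (\int[lebesgue_measure]_x f x =
   c%:E * \int[lebesgue_measure]_x f (x * c)%R)%E.
Proof.
move=> c0 mf f0.
pose h : measurableTypeR R -> measurableTypeR R := fun x => x * c.
have mh : measurable_fun setT h by exact: mulrr_measurable.
have nuE A : measurable A ->
    lebesgue_measure A = mscale (NngNum (ltW c0)) (pushforward lebesgue_measure h) A.
  apply: lebesgue_measure_unique => _ [[a b]] _ <-.
  rewrite /= /mscale /= /pushforward.
  rewrite [X in (_ * lebesgue_measure X)%E](_ : _ = `](a / c), (b / c)]%classic);
    last first.
    by apply/seteqP; split=> x /=; rewrite !in_itv/= ltr_pdivrMr// ler_pdivlMr.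
  rewrite !lebesgue_measure_itv/= !lte_fin ltr_pM2r ?invr_gt0//.
  case: ifP => _; last by rewrite mule0.
  by rewrite -!EFinB -EFinM -mulrBl mulrC divfK// gt_eqF.
rewrite (eq_measure_integral
  (mscale (NngNum (ltW c0)) (pushforward lebesgue_measure h))); last by move=> A mA _; exact: nuE.
rewrite ge0_integral_mscale//; congr (_ * _)%E.
by rewrite ge0_integral_pushforward.
Qed.

Lemma measurable_invr (R : realType) :
  measurable_fun [set: R] (fun x : R => x^-1).
Proof.
rewrite -(setUv [set 0]); apply/measurable_funU => //; first exact: measurableC.
split; first by apply: measurable_fun_set1.
apply: open_continuous_measurable_fun;
  first exact/closed_openC/accessible_closed_set1/hausdorff_accessible/norm_hausdorff.
by move=> x; rewrite inE => /eqP x0; exact: inv_continuous.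
Qed.

Lemma measurable_fun_div (R : realType) (d : measure_display)
    (T : measurableType d) (f g : T -> R) :
  measurable_fun setT f -> measurable_fun setT g ->
  measurable_fun setT (fun x => f x / g x).
Proof.
move=> mf mg; apply: measurable_funM => //.
by apply: measurableT_comp => //; exact: measurable_invr.
Qed.

(** By independence the law of the pair agrees with the product of the marginal laws on rectangles,
    hence everywhere, and Tonelli's theorem splits the integral. *)
Lemma joint_law (R : realType) (d : measure_display) (T : measurableType d)
    (P : probability T R) (d1 d2 : measure_display) (T1 : measurableType d1)
    (T2 : measurableType d2) (X : {mfun T >-> T1}) (V : {mfun T >-> T2})
    (h : T1 * T2 -> \bar R) :
  (forall A B, measurable A -> measurable B ->
     P (X @^-1` A `&` V @^-1` B) = P (X @^-1` A) * P (V @^-1` B))%E ->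
  measurable_fun setT h -> (forall p, 0 <= h p)%E ->
  (\int[P]_w h (X w, V w) =
   \int[distribution P V]_v \int[distribution P X]_x h (x, v))%E.
Proof.
move=> indep mh h0.
pose XV : T -> (T1 * T2)%type := fun w => (X w, V w).
have mXV : measurable_fun setT XV by exact: measurable_fun_pair.
rewrite -(@fubini_tonelli2 _ _ _ _ _ (distribution P X) (distribution P V) h)//.
rewrite (eq_measure_integral (pushforward P XV)).
  by rewrite ge0_integral_pushforward.
move=> A mA _.
apply: (@product_measure_unique _ _ _ _ _ (distribution P X) (distribution P V)
  (pushforward P XV)) => //.
Qed.

(* The hypotheses on X and V use the measurable structure of R, but
   lebesgue_measure lives on measurableTypeR R, whose display is different: hence
   the repackaging of X and V in the proof. *)
Lemma ratio_law (R : realType) (d : measure_display) (T : measurableType d)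
    (P : probability T R) (X V : T -> R) (fX fV : R -> R)
    (g : R * R -> \bar R) :
  measurable_fun setT X -> measurable_fun setT V ->
  (forall A B, measurable A -> measurable B ->
     P (X @^-1` A `&` V @^-1` B) = P (X @^-1` A) * P (V @^-1` B))%E ->
  has_density P X fX -> measurable_fun setT fX -> (forall x, 0 <= fX x) ->
  has_density P V fV -> measurable_fun setT fV -> (forall v, 0 <= fV v) ->
  (forall v, v <= 0 -> fV v = 0) ->
  measurable_fun setT g -> (forall p, 0 <= g p)%E ->
  (\int[P]_w g ((X w / V w)%R, V w) =
   \int[lebesgue_measure]_z \int[lebesgue_measure]_v
     (g (z, v) * (fX (z * v) * fV v * v)%:E))%E.
Proof.
move=> mX mV indep dX mfX fX0 dV mfV fV0 fVle0 mg g0.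
pose X' : {mfun T >-> measurableTypeR R} :=
  MeasurableFun.Pack (MeasurableFun.Class
    (isMeasurableFun.Build _ _ _ (measurableTypeR R) X mX)).
pose V' : {mfun T >-> measurableTypeR R} :=
  MeasurableFun.Pack (MeasurableFun.Class
    (isMeasurableFun.Build _ _ _ (measurableTypeR R) V mV)).
pose h (p : R * R) := g (p.1 / p.2, p.2).
have mh : measurable_fun setT h.
  apply: measurableT_comp => //; apply: measurable_fun_pair => //=.
  exact: measurable_fun_div.
have h0 p : (0 <= h p)%E by exact: g0.
pose hf (p : R * R) := (h p * (fX p.1)%:E)%E.
have mhf : measurable_fun setT hf.
  apply: emeasurable_funM => //; apply/measurable_EFinP.
  by apply: measurableT_comp.
have hf0 p : (0 <= hf p)%E by rewrite mule_ge0// lee_fin.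
have hdX v : (\int[distribution P X']_x h (x, v) =
    \int[lebesgue_measure]_x hf (x, v))%E.
  rewrite (@ge0_integral_density _ _ _ _ lebesgue_measure fX)//.
  exact: measurable_fun_pair1.
rewrite (@joint_law _ _ _ _ _ _ _ _ X' V' h)//.
under eq_integral do rewrite hdX.
have mG := @measurable_fun_fubini_tonelli_G _ _ _ _ _ (@lebesgue_measure R) hf mhf hf0.
rewrite (@ge0_integral_density _ _ _ _ lebesgue_measure fV)//; last first.
  by move=> v; exact: integral_ge0.
(* The absolute value keeps [k] nonnegative, so that Tonelli's theorem applies; it changes nothing
   because [fV] vanishes at [v <= 0]. *)
pose k (p : R * R) := (g p * (fX (p.1 * p.2) * fV p.2 * `|p.2|)%:E)%E.
have mk : measurable_fun setT k.
  apply: emeasurable_funM => //; apply/measurable_EFinP.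
  apply: measurable_funM; last exact: measurableT_comp.
  apply: measurable_funM; last exact: measurableT_comp.
  by apply: measurableT_comp => //; exact: measurable_funM.
have k0 p : (0 <= k p)%E by rewrite mule_ge0// lee_fin !mulr_ge0.
have kE z v : k (z, v) = (g (z, v) * (fX (z * v) * fV v * v)%:E)%E.
  rewrite /k/=; have [v0|/ltW v0] := leP v 0.
    by rewrite fVle0// mulr0 !mul0r.
  by rewrite ger0_norm.
under [RHS]eq_integral do under eq_integral do rewrite -kE.
rewrite -[RHS](@fubini_tonelli1 _ _ _ _ _ lebesgue_measure lebesgue_measure k)//.
rewrite (@fubini_tonelli2 _ _ _ _ _ lebesgue_measure lebesgue_measure k)//.
apply: eq_integral => v _; rewrite /fubini_G.
have [v0|v0] := leP v 0.
  rewrite fVle0// mule0 integral0_eq// => x _.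
  by rewrite kE fVle0// mulr0 mul0r mule0.
have mhfv : measurable_fun setT (fun x => hf (x, v)).
  exact: measurable_fun_pair1.
(* Substitution [x = z * v] at fixed [v > 0]; its Jacobian is the last factor [v] of the joint
   density. *)
rewrite (@ge0_integral_scale _ v)// muleAC muleC.
rewrite -EFinM -ge0_integralZr//; last 2 first.
- by apply: (measurableT_comp mhfv); exact: mulrr_measurable.
- by rewrite lee_fin mulr_ge0// ltW.
by apply: eq_integral => x _; rewrite kE /hf /h/= mulfK ?gt_eqF//
  -muleA -EFinM [v * _]mulrC mulrA.
Qed.

(** * Signs of derivatives and linear substitutions *)

Lemma derive1_ge0_near (R : realType) (f : R -> R) (x : R) :
  derivable f x 1 -> (\forall y \near x, 0 <= (f y - f x) * (y - x)) ->
  0 <= derive1 f x.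
Proof.
move=> df fx; apply: limr_ge.
  under eq_fun; first (move=> h; rewrite -{2}(scaler1 h); over).
  exact: df.
have shx : (h + x) @[h --> (0 : R)] --> x.
  rewrite -[X in _ --> X]add0r.
  by apply: cvgD; [exact: cvg_id|exact: cvg_cst].
near=> h.
have fh : 0 <= (f (h + x) - f x) * (h + x - x).
  by near: h; apply: cvg_within; exact: shx fx.
rewrite /GRing.scale/=.
(* At [h = 0] the quotient is 0 by the convention [0^-1 = 0]. *)
have [->|h0] := eqVneq h 0; first by rewrite invr0 mul0r.
rewrite addrK in fh.
rewrite (_ : h^-1 * _ = (f (h + x) - f x) * h * h^-1 ^+ 2); last by field.
by rewrite mulr_ge0// sqr_ge0.
Unshelve. all: by end_near. Qed.

Lemma integral_scale (R : realType) (c : R) (f : R -> \bar R) : 0 < c ->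
  (@lebesgue_measure R).-integrable setT f ->
  (@lebesgue_measure R).-integrable setT (fun x => f (x * c)) /\
  (\int[lebesgue_measure]_x f x =
   c%:E * \int[lebesgue_measure]_x f (x * c)%R)%E.
Proof.
move=> c0 /integrableP[mf intf].
have mfc : measurable_fun [set: R] (fun x => f (x * c)).
  by apply: (measurableT_comp mf); exact: mulrr_measurable.
have ifc : (@lebesgue_measure R).-integrable setT (fun x => f (x * c)).
  apply/integrableP; split => //.
  move: intf; rewrite (@ge0_integral_scale _ c)//; last exact: measurableT_comp.
  (* Since [c > 0], an infinite integral of the rescaled function would make the original one
     infinite. *)
  case: (\int[_]_x _)%E => [r _| |].
  - exact: ltry.
  - by rewrite gt0_muley// lte_fin.
  - by [].
split => //; rewrite integralE [X in (c%:E * X)%E]integralE muleBr//; last first.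
  exact: integrable_add_def ifc.
rewrite (@ge0_integral_scale _ c (f^\+)%E)//; last exact: measurable_funepos.
rewrite (@ge0_integral_scale _ c (f^\-)%E)//; last exact: measurable_funeneg.
by congr (_ * _ - _ * _)%E; apply: eq_integral => x _; rewrite ?funeposE ?funenegE.
Qed.

(** Extension by zero reduces this to the whole line, as the half-line is invariant under scaling by
    [c > 0]. *)
Lemma integral_scale_pos (R : realType) (c : R) (f : R -> R) : 0 < c ->
  (@lebesgue_measure R).-integrable `]0, +oo[ (EFin \o f) ->
  (@lebesgue_measure R).-integrable `]0, +oo[ (fun x => (f (x * c))%:E) /\
  (\int[lebesgue_measure]_(x in `]0, +oo[) f x =
   c * \int[lebesgue_measure]_(x in `]0, +oo[) f (x * c))%R.
Proof.
move=> c0 intf.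
have scaleE :
    (fun x => (f (x * c))%:E) \_ `]0, +oo[%classic =
    (fun x => ((EFin \o f) \_ `]0, +oo[%classic) (x * c)).
  apply/funext => x; rewrite !patchE.
  have -> // : (x \in `]0, +oo[%classic) = (x * c \in `]0, +oo[%classic).
  by apply/idP/idP; rewrite !inE /= !in_itv /= !andbT pmulr_lgt0.
have /(integral_scale _ c _ c0)[ifc ifcE] :
    (@lebesgue_measure R).-integrable setT ((EFin \o f) \_ `]0, +oo[%classic).
  by apply: iffLR intf; exact: integrable_mkcond.
have intfc : (@lebesgue_measure R).-integrable `]0, +oo[
    (fun x => (f (x * c))%:E).
  by rewrite -scaleE in ifc; apply: iffRL ifc; exact: integrable_mkcond.
split => //; rewrite /Rintegral [X in fine X]integral_mkcond ifcE.
rewrite [X in _ * fine X]integral_mkcond scaleE -[c]/(fine c%:E) -fineM//.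
rewrite -scaleE -integral_mkcond; exact: integrable_fin_num.
Qed.

(** * The sign of [L'] and its integrals against gamma kernels *)

Lemma bowl_derive1_le0 (R : realType) (L : R -> R) (t : R) :
  bowl_loss L -> 0 < t < 1 -> derive1 L t <= 0.
Proof.
move=> [_ dL _ Ldecr _] /andP[t0 t1]; rewrite -oppr_ge0 -[leRHS]derive1N; last first.
  exact: dL.
apply: derive1_ge0_near; first by apply: derivableN; exact: dL.
near=> y.
have y0 : 0 < y by near: y; exact: lt_nbhsr.
have y1 : y < 1 by near: y; exact: lt_nbhsl.
have -> : (- L) y - (- L) t = L t - L y by rewrite !fctE; ring.
have [ty|/ltW yt] := leP t y.
  by rewrite mulr_ge0 ?subr_ge0//; apply: Ldecr => //; exact: ltW.
by rewrite mulr_le0 ?subr_le0//; apply: Ldecr => //; exact: ltW.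
Unshelve. all: by end_near. Qed.

Lemma bowl_derive1_ge0 (R : realType) (L : R -> R) (t : R) :
  bowl_loss L -> 1 < t -> 0 <= derive1 L t.
Proof.
move=> [_ dL _ _ Lincr] t1.
apply: derive1_ge0_near; first by apply: dL; rewrite (lt_trans _ t1).
near=> y.
have y1 : 1 < y by near: y; exact: lt_nbhsr.
have [ty|/ltW yt] := leP t y.
  by rewrite mulr_ge0 ?subr_ge0//; apply: Lincr => //; exact: ltW.
by rewrite mulr_le0 ?subr_le0//; apply: Lincr => //; exact: ltW.
Unshelve. all: by end_near. Qed.

(** Up to a constant, the integrand of [E L'(W / s)], [W ~ Gamma(k + 1, 1)], after the substitution
    [w = s u]. The parameter moves out of the argument of [L'] into the weight, so the sign change
    stays at [u = 1] for every [s]. *)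
Definition damped_derive {R : realType} (L : R -> R) (k : nat) (s u : R) : R :=
  derive1 L u * u ^+ k * expR (- (s * u)).

Lemma integral_damped_derive (R : realType) (L : R -> R) (k : nat) (s : R) :
  0 < s -> gamma_integrable k.+1 (fun w => derive1 L (w * s^-1)) ->
  (@lebesgue_measure R).-integrable `]0, +oo[ (EFin \o damped_derive L k s) /\
  \int[lebesgue_measure]_(u in `]0, +oo[) damped_derive L k s u =
  s^-1 ^+ k.+1 * k`!%:R * gamma_mean k.+1 (fun w => derive1 L (w * s^-1)).
Proof.
move=> s0 intL.
(* [C] cancels the normalisation [k!] of the gamma density and the power [s ^+ k] produced by the
   substitution. *)
pose C := s^-1 ^+ k * k`!%:R.
pose f w := C * (derive1 L (w * s^-1) * gamma_pdf k.+1 1 w).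
have intf : (@lebesgue_measure R).-integrable `]0, +oo[ (EFin \o f).
  by apply: (integrableZl _ C intL).
have [ifs ifsE] := integral_scale_pos _ s f s0 intf.
have fE : {in `]0, +oo[%classic, forall u, f (u * s) = damped_derive L k s u}.
  move=> u; rewrite inE/= in_itv/= andbT => u0.
  rewrite /f /damped_derive /gamma_pdf mulr_gt0// mulfK ?gt_eqF// /C expr1n !mulr1 divr1 /=.
  rewrite exprMn exprVn mulrC (mulrC s).
  have kn0 : k`!%:R != 0 :> R by rewrite pnatr_eq0 gtn_eqF// fact_gt0.
  have sn0 : s ^+ k != 0 by rewrite expf_neq0// gt_eqF.
  by field; rewrite kn0 sn0.
split.
  apply: eq_integrable ifs => // u uD; by rewrite /= fE.
transitivity (\int[lebesgue_measure]_(x in `]0, +oo[) f (x * s)).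
  by apply: eq_Rintegral => u /fE.
apply: (mulfI (lt0r_neq0 s0)); rewrite -ifsE /f RintegralZl//.
rewrite /C /gamma_mean exprS !mulrA divff ?mul1r// gt_eqF//.
Qed.

(** Comparison with the zero integral at [beta^-1] gives nonnegativity only; strictness comes from
    uniqueness of the root, since a zero integral at [s] would make [s^-1] a second root. *)
Lemma integral_damped_derive_gt0 (R : realType) (L : R -> R) (k : nat) (s beta : R) :
  bowl_loss L ->
  (forall c, 0 < c -> gamma_integrable k.+1 (fun w => derive1 L (w * c))) ->
  is_unique_root k.+1 L beta -> 0 < s < beta^-1 ->
  0 < \int[lebesgue_measure]_(u in `]0, +oo[) damped_derive L k s u.
Proof.
move=> bL intL [beta0 rootb uniqb] /andP[s0 sb].
have [|ipsi psiE] := @integral_damped_derive _ L k _ s0; first by apply: intL; rewrite invr_gt0.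
have bV0 : 0 < beta^-1 by rewrite invr_gt0.
have [|ipsib psibE] := @integral_damped_derive _ L k _ bV0; first by apply: intL; rewrite invrK.
rewrite lt_def; apply/andP; split.
  rewrite psiE !mulf_neq0//.
  - by rewrite expf_neq0// invr_eq0 gt_eqF.
  - apply/eqP => /uniqb; rewrite invr_gt0 => /(_ s0) sE.
    by move: sb; rewrite -sE invrK ltxx.
(* [C] is the value at [u = 1] of the increasing ratio of the two exponentials, so the ratio crosses
   [C] exactly where [L'] changes sign. *)
pose C := expR (beta^-1 - s).
rewrite [leLHS](_ : 0 =
    C * \int[lebesgue_measure]_(u in `]0, +oo[) damped_derive L k beta^-1 u); last first.
  by rewrite psibE invrK rootb !mulr0.
rewrite -RintegralZl//; apply: le_Rintegral => //.
  by apply: (integrableZl _ C ipsib).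
move=> u; rewrite /= in_itv/= andbT => u0; rewrite /damped_derive /C.
have -> : expR (- (s * u)) =
    expR (beta^-1 - s) * expR (- (beta^-1 * u)) * expR ((beta^-1 - s) * (u - 1)).
  by rewrite -!expRD; congr expR; ring.
rewrite mulrCA -subr_ge0 [X in 0 <= X](_ : _ = expR (beta^-1 - s) *
  expR (- (beta^-1 * u)) * u ^+ k * (derive1 L u * (expR ((beta^-1 - s) * (u - 1)) - 1))); last by ring.
apply: mulr_ge0.
  by rewrite !mulr_ge0 ?expR_ge0 ?exprn_ge0// ltW.
have [u1|u1|->] := ltgtP u 1; last by rewrite subrr mulr0 expR0 subrr mulr0.
  rewrite mulr_le0 ?bowl_derive1_le0 ?u0// subr_le0 -[leRHS]expR0 ler_expR.
  by rewrite mulr_ge0_le0// ?subr_ge0 ?subr_le0 ltW.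
rewrite mulr_ge0 ?bowl_derive1_ge0// subr_ge0 -[leLHS]expR0 ler_expR.
by rewrite mulr_ge0// ?subr_ge0 ltW.
Qed.

(** * The joint density of the ratio and [V2], and its monotone weight [m] *)

Definition ordstat_weight {R : realType} (a : nat) (mu s z v : R) : R :=
  if mu < z * v then (1 - expR (- ((z * v - mu) / s))) ^+ a.-1 else 0.

Lemma ordstat_weight_ge0 (R : realType) (a : nat) (mu s z v : R) :
  0 < s -> 0 <= ordstat_weight a mu s z v.
Proof.
move=> s0; rewrite /ordstat_weight; case: ifPn => // muzv.
rewrite exprn_ge0// subr_ge0 -[leRHS]expR0 ler_expR oppr_le0.
by rewrite divr_ge0 ?subr_ge0// ltW.
Qed.

Lemma ordstat_weight_gt0 (R : realType) (a : nat) (mu s z v : R) :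
  0 < s -> mu < z * v -> 0 < ordstat_weight a mu s z v.
Proof.
move=> s0 muzv; rewrite /ordstat_weight muzv.
rewrite exprn_gt0// subr_gt0 -[ltRHS]expR0 ltr_expR oppr_lt0.
by rewrite divr_gt0 ?subr_gt0.
Qed.

(** The weight is 0 up to [z * v = mu] and beyond it a power of a nonnegative nondecreasing
    function; for [a = 1] it is the indicator of [mu < z * v]. *)
Lemma le_ordstat_weight (R : realType) (a : nat) (mu s z v v' : R) :
  0 < s -> 0 <= z -> v <= v' ->
  ordstat_weight a mu s z v <= ordstat_weight a mu s z v'.
Proof.
move=> s0 z0 vv'; have zvv' : z * v <= z * v' by rewrite ler_wpM2l.
have [muzv|zvmu] := ltP mu (z * v); last first.
  by rewrite [leLHS]/ordstat_weight ltNge zvmu/=; exact: ordstat_weight_ge0.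
rewrite /ordstat_weight muzv (lt_le_trans muzv)//.
set e := 1 - expR _; set e' := 1 - expR _.
have e0 : 0 <= e.
  rewrite subr_ge0 -[leRHS]expR0 ler_expR oppr_le0.
  by rewrite divr_ge0 ?subr_ge0// ltW.
have ee' : e <= e'.
  by rewrite lerD2l lerN2 ler_expR lerN2 ler_pM2r ?invr_gt0// lerD2r.
by rewrite lerXn2r// nnegrE (le_trans e0).
Qed.

(** Collects the factors free of both [z] and [v]; the exponential is what remains of the location
    once it is pulled out of the order statistic density. *)
Definition ratio_const {R : realType} (n a b : nat) (th : param R) : R :=
  n`!%:R / ((a.-1)`!%:R * (n - a)`!%:R) * (sigma2 th)^-1
  * expR ((n - a + 1)%:R * (mu2 th / sigma2 th))
  / ((b - a).-1`!%:R * sigma2 th ^+ (b - a)).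

Lemma ratio_const_gt0 (R : realType) (n a b : nat) (th : param R) :
  0 < sigma2 th -> 0 < ratio_const n a b th.
Proof.
move=> s0; have f0 m : 0 < m`!%:R :> R by rewrite ltr0n fact_gt0.
by rewrite /ratio_const !(mulr_gt0, invr_gt0, expR_gt0, exprn_gt0).
Qed.

Lemma ratio_pdfE (R : realType) (n a b : nat) (th : param R) (z v : R) :
  (a < b)%N -> 0 < v ->
  ratio_pdf n a b th z v =
  ratio_const n a b th * ordstat_weight a (mu2 th) (sigma2 th) z v
  * v ^+ (b - a) * expR (- ((1 + (n - a + 1)%:R * z) / sigma2 th * v)).
Proof.
move=> ab v0; rewrite /ratio_pdf /ordstat_pdf /gamma_pdf v0 /ordstat_weight.
case: ifPn => _; last by rewrite !(mulr0, mul0r).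
set N := (n - a + 1)%N.
have E12 : expR (- ((z * v - mu2 th) / sigma2 th)) ^+ N * expR (- (v / sigma2 th)) =
    expR (N%:R * (mu2 th / sigma2 th)) * expR (- ((1 + N%:R * z) / sigma2 th * v)).
  by rewrite -expRM_natl -!expRD; congr expR; ring.
(* The Jacobian [v] raises the gamma exponent by one; [a < b] makes the predecessor genuine. *)
have -> : v ^+ (b - a) = v ^+ (b - a).-1 * v.
  by rewrite -exprSr prednK// subn_gt0.
rewrite /ratio_const -/N.
rewrite [LHS](_ : _ = (n`!%:R / ((a.-1)`!%:R * (n - a)`!%:R)) * (sigma2 th)^-1
  * (1 - expR (- ((z * v - mu2 th) / sigma2 th))) ^+ a.-1 * v ^+ (b - a).-1 * v
  / ((b - a).-1`!%:R * sigma2 th ^+ (b - a)) *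
  (expR (- ((z * v - mu2 th) / sigma2 th)) ^+ N * expR (- (v / sigma2 th)))).
  by rewrite E12; ring.
by ring.
Qed.

(** After [u = c v], the difference of the two integrands is a nonnegative factor times
    [L'(c v) (m(v) - m(1 / c))]. Both terms of this product change sign at [v = 1 / c], in the same
    direction. *)
Lemma ratio_deriv_ge (R : realType) (L : R -> R) (n a b : nat) (th : param R)
    (z c : R) :
  bowl_loss L -> (a < b)%N -> 0 < sigma2 th -> 0 < z -> 0 < c ->
  (forall c : R, 0 < c ->
     gamma_integrable (b - a).+2 (fun w => derive1 L (w * c))) ->
  diff_under_integral L (ratio_pdf n a b th z) ->
  ratio_const n a b th * ordstat_weight a (mu2 th) (sigma2 th) z c^-1
  * c^-1 ^+ (b - a).+2
  * \int[lebesgue_measure]_(u in `]0, +oo[)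
      damped_derive L (b - a).+1 ((1 + (n - a + 1)%:R * z) / (sigma2 th * c)) u <=
  \int[lebesgue_measure]_(v in `]0, +oo[)
     (v * derive1 L (c * v) * ratio_pdf n a b th z v).
Proof.
move=> bL ab s0 z0 c0 intL /(_ c c0)[_ intF _].
set K := ratio_const n a b th; set N := (n - a + 1)%N.
set s := (1 + N%:R * z) / (sigma2 th * c).
have K0 : 0 < K by exact: ratio_const_gt0.
have s1 : 0 < s.
  by rewrite /s divr_gt0 ?mulr_gt0// ltr_pwDl// mulr_ge0// ltW.
have [|ipsi _] := @integral_damped_derive _ L (b - a).+1 _ s1.
  by apply: intL; rewrite invr_gt0.
have [ipsic ->] := integral_scale_pos _ c _ c0 ipsi.
set m := ordstat_weight a (mu2 th) (sigma2 th) z.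
(* One factor [c^-1] fewer than in the statement: the other cancels against the Jacobian of
   [u = c v]. *)
pose C := K * m c^-1 * c^-1 ^+ (b - a).+1.
rewrite [leLHS](_ : _ =
  C * \int[lebesgue_measure]_(v in `]0, +oo[) damped_derive L (b - a).+1 s (v * c)); last first.
  rewrite /C [_ ^+ _.+2]exprSr -/(m _); field.
  by rewrite gt_eqF.
rewrite -RintegralZl//; apply: le_Rintegral => //.
  by apply: (integrableZl _ C ipsic).
move=> v; rewrite /= in_itv/= andbT => v0; rewrite ratio_pdfE// -/K -/N -/(m v).
rewrite /damped_derive /C (mulrC v c) -subr_ge0.
have -> : expR (- (s * (c * v))) = expR (- ((1 + N%:R * z) / sigma2 th * v)).
  by congr expR; rewrite /s; field; rewrite !gt_eqF.
rewrite exprMn.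
set E := expR _.
have -> : v * derive1 L (c * v) * (K * m v * v ^+ (b - a) * E) -
   K * m c^-1 * c^-1 ^+ (b - a).+1 *
     (derive1 L (c * v) * (c ^+ (b - a).+1 * v ^+ (b - a).+1) * E) =
   K * v ^+ (b - a).+1 * E * (derive1 L (c * v) * (m v - m c^-1)).
  rewrite exprVn (exprS v); field.
  by rewrite expf_neq0// gt_eqF.
apply: mulr_ge0; first exact: mulr_ge0 (mulr_ge0 (ltW K0) (exprn_ge0 _ (ltW v0))) (expR_ge0 _).
have [cv1|cv1|cv1] := ltgtP (c * v) 1.
- rewrite mulr_le0 ?bowl_derive1_le0 ?mulr_gt0// subr_le0 le_ordstat_weight ?(ltW z0)//.
  by rewrite -[c^-1]mul1r ler_pdivlMr// mulrC ltW.
- rewrite mulr_ge0 ?bowl_derive1_ge0// subr_ge0 le_ordstat_weight ?(ltW z0)//.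
  by rewrite -[c^-1]mul1r ler_pdivrMr// mulrC ltW.
- have -> : v = c^-1 by rewrite -[v](mulKf (lt0r_neq0 c0)) cv1 mulr1.
  by rewrite subrr mulr0.
Qed.

(** Conditional expected loss given the ratio [z], not divided by the marginal density at [z]: this
    division would not affect comparisons in [c]. *)
Definition ratio_loss {R : realType} (L : R -> R) (n a b : nat) (th : param R)
    (z c : R) : R :=
  \int[lebesgue_measure]_(v in `]0, +oo[) (L (c * v) * ratio_pdf n a b th z v).

(** * Monotonicity of the conditional expected loss above the threshold *)

Section ratio_loss_monotone.
Context {R : realType}.
Variables (L : R -> R) (n a b : nat) (th : param R) (z beta : R).
Hypotheses (bL : bowl_loss L) (ab : (a < b)%N) (s0 : 0 < sigma2 th) (z0 : 0 < z).
Hypothesis intL : forall c : R, 0 < c ->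
  gamma_integrable (b - a).+2 (fun w => derive1 L (w * c)).
Hypothesis difL : diff_under_integral L (ratio_pdf n a b th z).
Hypothesis rootL : is_unique_root (b - a).+2 L beta.

(** Mean value theorem combined with the bound on the derivative. The weight is kept as a factor
    because it may vanish when [mu2 th > 0]: its nonnegativity yields weak monotonicity, its
    positivity the strict one. *)
Lemma ratio_loss_diff (c1 c2 : R) :
  threshold n a beta z <= sigma2 th * c1 -> c1 < c2 ->
  exists c K : R, [/\ 0 < c, 0 < K &
  K * ordstat_weight a (mu2 th) (sigma2 th) z c^-1 <=
  ratio_loss L n a b th z c2 - ratio_loss L n a b th z c1].
Proof.
move=> thrc c12; have beta0 : 0 < beta by case: rootL.
have t0 : 0 < 1 + (n - a + 1)%:R * z by rewrite ltr_pwDl// mulr_ge0// ltW.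
have c10 : 0 < c1.
  rewrite -(pmulr_rgt0 _ s0); apply: lt_le_trans thrc.
  by rewrite /threshold mulr_gt0.
pose F' (c : R) := \int[lebesgue_measure]_(v in `]0, +oo[)
  (v * derive1 L (c * v) * ratio_pdf n a b th z v).
have dF (c : R) : 0 < c -> is_derive c 1 (ratio_loss L n a b th z) (F' c).
  by move=> /difL[].
have [||c /[!in_itv]/= /andP[c1c cc2] FE] :=
  @MVT R (ratio_loss L n a b th z) F' c1 c2 c12.
- move=> x /[!in_itv]/= /andP[c1x _]; apply: dF; exact: lt_trans c1x.
- apply: derivable_within_continuous => x /[!in_itv]/= /andP[c1x _].
  by have [] := dF x (lt_le_trans c10 c1x).
have c0 : 0 < c by exact: lt_trans c1c.
set s := (1 + (n - a + 1)%:R * z) / (sigma2 th * c).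
(* The intermediate point satisfies [c > c1], so [s < beta^-1] strictly even when [c1] sits on the
   threshold. *)
have J0 : 0 < \int[lebesgue_measure]_(u in `]0, +oo[) damped_derive L (b - a).+1 s u.
  apply: (@integral_damped_derive_gt0 _ _ _ _ beta) => //.
  rewrite divr_gt0 ?mulr_gt0//= ltr_pdivrMr ?mulr_gt0// ltr_pdivlMl//.
  by rewrite (le_lt_trans thrc)// ltr_pM2l.
exists c, (ratio_const n a b th * c^-1 ^+ (b - a).+2 *
  (\int[lebesgue_measure]_(u in `]0, +oo[) damped_derive L (b - a).+1 s u) * (c2 - c1)).
split; first by [].
  apply: mulr_gt0; last by rewrite subr_gt0.
  apply: mulr_gt0 => //; apply: mulr_gt0; first exact: ratio_const_gt0.
  by rewrite exprn_gt0// invr_gt0.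
rewrite FE mulrAC ler_pM2r ?subr_gt0//.
apply: le_trans (@ratio_deriv_ge _ _ _ _ _ _ _ _ bL ab s0 z0 c0 intL difL).
by rewrite -/s le_eqVlt; apply/orP; left; apply/eqP; ring.
Qed.

Lemma le_ratio_loss (c1 c2 : R) : threshold n a beta z <= sigma2 th * c1 -> c1 <= c2 ->
  ratio_loss L n a b th z c1 <= ratio_loss L n a b th z c2.
Proof.
move=> thrc; rewrite le_eqVlt => /predU1P[->//|c12].
have [c [K [_ K0 FE]]] := ratio_loss_diff _ _ thrc c12.
rewrite -subr_ge0; apply: le_trans FE; rewrite mulr_ge0 ?(ltW K0)//.
exact: ordstat_weight_ge0.
Qed.

Lemma lt_ratio_loss c1 c2 : mu2 th <= 0 ->
  threshold n a beta z <= sigma2 th * c1 -> c1 < c2 ->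
  ratio_loss L n a b th z c1 < ratio_loss L n a b th z c2.
Proof.
move=> mu0 thrc c12; have [c [K [c0 K0 FE]]] := ratio_loss_diff _ _ thrc c12.
rewrite -subr_gt0; apply: lt_le_trans FE; rewrite mulr_gt0//.
apply: ordstat_weight_gt0 => //; apply: (le_lt_trans mu0).
by rewrite mulr_gt0// invr_gt0.
Qed.

End ratio_loss_monotone.

(** * Measurability and sign of the densities *)

Lemma measurable_ordstat_pdf (R : realType) (n a : nat) (mu s : R) :
  measurable_fun [set: R] (ordstat_pdf n a mu s).
Proof.
apply: measurable_fun_ifT => //; first exact: measurable_fun_ltr.
have me : measurable_fun [set: R] (fun x : R => expR (- ((x - mu) / s))).
  apply: measurableT_comp => //; apply: measurableT_comp => //.
  by apply: measurable_funM => //; exact: measurable_funB.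
apply: measurable_funM; last exact: measurable_funX.
apply: measurable_funM => //; apply: measurable_funM => //.
by apply: measurable_funX; exact: measurable_funB.
Qed.

Lemma measurable_gamma_pdf (R : realType) (k : nat) (s : R) :
  measurable_fun [set: R] (gamma_pdf k s).
Proof.
apply: measurable_fun_ifT => //; first exact: measurable_fun_ltr.
apply: measurable_funM => //; apply: measurable_funM; first exact: measurable_funX.
apply: measurableT_comp => //; apply: measurableT_comp => //.
exact: measurable_funM.
Qed.

Lemma ordstat_pdf_ge0 (R : realType) (n a : nat) (mu s x : R) :
  0 < s -> 0 <= ordstat_pdf n a mu s x.
Proof.
move=> s0; rewrite /ordstat_pdf; case: ifPn => // mux.
rewrite !mulr_ge0 ?invr_ge0 ?mulr_ge0 ?exprn_ge0 ?expR_ge0 ?(ltW s0)//.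
rewrite subr_ge0 -[leRHS]expR0 ler_expR oppr_le0.
by rewrite divr_ge0 ?subr_ge0// ltW.
Qed.

Lemma gamma_pdf_ge0 (R : realType) (k : nat) (s x : R) :
  0 < s -> 0 <= gamma_pdf k s x.
Proof.
move=> s0; rewrite /gamma_pdf; case: ifPn => // x0.
by rewrite divr_ge0 ?mulr_ge0 ?exprn_ge0 ?expR_ge0// ltW.
Qed.

Lemma gamma_pdf_le0 (R : realType) (k : nat) (s x : R) :
  x <= 0 -> gamma_pdf k s x = 0.
Proof. by move=> x0; rewrite /gamma_pdf ltNge x0. Qed.

Lemma ratio_pdf_ge0 (R : realType) (n a b : nat) (th : param R) (z v : R) :
  0 < sigma2 th -> 0 <= ratio_pdf n a b th z v.
Proof.
move=> s0; rewrite /ratio_pdf; have [v0|/ltW v0] := leP v 0.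
  by rewrite gamma_pdf_le0// mulr0 mul0r.
by rewrite !mulr_ge0 ?ordstat_pdf_ge0 ?gamma_pdf_ge0.
Qed.

Lemma measurable_ratio_pdf (R : realType) (n a b : nat) (th : param R) :
  measurable_fun [set: R * R] (fun p => ratio_pdf n a b th p.1 p.2).
Proof.
apply: measurable_funM => //; apply: measurable_funM.
  apply: (measurableT_comp (measurable_ordstat_pdf _ _ _ _ _)).
  exact: measurable_funM.
exact: (measurableT_comp (measurable_gamma_pdf _ _ _)).
Qed.

(** * The risk as an integral of conditional risks over the ratio *)

Lemma bowl_loss_ge0 (R : realType) (L : R -> R) (t : R) :
  bowl_loss L -> 0 < t -> 0 <= L t.
Proof.
move=> [_ _ L1 Ldecr Lincr] t0; rewrite -L1.
by have [t1|/ltW t1] := leP t 1; [exact: Ldecr|exact: Lincr].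
Qed.

(* Nonnegative everywhere, as Tonelli's theorem requires; a bowl-shaped loss may
   be negative at t <= 0. *)
Definition loss_on_pos {R : realType} (L : R -> R) (t : R) : R :=
  if 0 < t then L t else 0.

Lemma loss_on_pos_ge0 (R : realType) (L : R -> R) (t : R) :
  bowl_loss L -> 0 <= loss_on_pos L t.
Proof.
by move=> bL; rewrite /loss_on_pos; case: ifPn => // /(bowl_loss_ge0 _ _ _ bL).
Qed.

Lemma measurable_loss_on_pos (R : realType) (L : R -> R) :
  bowl_loss L -> measurable_fun setT (loss_on_pos L).
Proof.
by move=> [mL _ _ _ _]; apply: measurable_fun_ifT => //; exact: measurable_fun_ltr.
Qed.

(** Extended-real, so that it makes sense at every [z]: finiteness is assumed only for [z > 0],
    where [cond_riskE] identifies it with [ratio_loss]. *)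
Definition cond_risk {R : realType} (n a b : nat) (L : R -> R) (th : param R)
    (psi : R -> R) (z : R) : \bar R :=
  (\int[lebesgue_measure]_v
     ((loss_on_pos L (psi z * v / sigma2 th))%:E *
      (ratio_pdf n a b th z v)%:E))%E.

Section risk_as_ratio_integral.
Context {R : realType} {n1 a1 b1 n2 a2 b2 : nat}
  {d : measure_display} {T : measurableType d}
  {P : param R -> probability T R} {X1 X2 V1 V2 : {mfun T >-> R}}.
Hypothesis hmodel : censored_exp_model n1 a1 b1 n2 a2 b2 P X1 X2 V1 V2.
Context {L : R -> R}.
Hypothesis bL : bowl_loss L.
Context {th : param R}.
Hypothesis hth : in_Theta th.

Lemma sigma2_gt0 : 0 < sigma2 th.
Proof. by have /andP[s1 s12] := hth; exact: lt_le_trans s12. Qed.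

Lemma model_ratio_law (g : R * R -> \bar R) :
  measurable_fun setT g -> (forall p, 0 <= g p)%E ->
  (\int[P th]_w g ((X2 w / V2 w)%R, V2 w) =
   \int[lebesgue_measure]_z \int[lebesgue_measure]_v
     (g (z, v) * (ratio_pdf n2 a2 b2 th z v)%:E))%E.
Proof.
move=> mg g0; have [_ dX _ dV indep] := hmodel _ hth.
have s0 := sigma2_gt0.
apply: ratio_law => //.
- move=> A B mA mB; have := indep setT A setT B measurableT mA measurableT mB.
  by rewrite !preimage_setT setTI setIT probability_setT mul1e mule1.
- exact: measurable_ordstat_pdf.
- by move=> x; exact: ordstat_pdf_ge0.
- exact: measurable_gamma_pdf.
- by move=> v; exact: gamma_pdf_ge0.
- by move=> v; exact: gamma_pdf_le0.
Qed.

Lemma V2_le0_null : P th [set w | V2 w <= 0] = 0.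
Proof.
have [_ _ _ dV _] := hmodel _ hth.
have := dV `]-oo, 0]%classic (measurable_itv _).
rewrite integral0_eq; last first.
  by move=> v; rewrite /= in_itv/= => v0; rewrite gamma_pdf_le0.
by [].
Qed.

Lemma measurable_cond_risk_integrand (psi : R -> R) : measurable_fun setT psi ->
  measurable_fun [set: R * R]
    (fun p => ((loss_on_pos L (psi p.1 * p.2 / sigma2 th))%:E *
      (ratio_pdf n2 a2 b2 th p.1 p.2)%:E)%E).
Proof.
move=> mpsi; apply: emeasurable_funM.
  apply/measurable_EFinP; apply: (measurableT_comp (measurable_loss_on_pos _ _ bL)).
  apply: measurable_funM => //; apply: measurable_funM => //.
  exact: measurableT_comp.
by apply/measurable_EFinP; exact: measurable_ratio_pdf.
Qed.

Lemma cond_risk_ge0 (psi : R -> R) (z : R) : (0 <= cond_risk n2 a2 b2 L th psi z)%E.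
Proof.
apply: integral_ge0 => v _; rewrite mule_ge0// lee_fin.
  exact: loss_on_pos_ge0.
exact: (ratio_pdf_ge0 _ _ _ _ _ _ _ sigma2_gt0).
Qed.

Lemma measurable_cond_risk (psi : R -> R) : measurable_fun setT psi ->
  measurable_fun setT (cond_risk n2 a2 b2 L th psi).
Proof.
move=> mpsi.
apply: (@measurable_fun_fubini_tonelli_F _ _ _ _ _ (@lebesgue_measure R)
  (fun p => ((loss_on_pos L (psi p.1 * p.2 / sigma2 th))%:E *
      (ratio_pdf n2 a2 b2 th p.1 p.2)%:E)%E)).
  exact: measurable_cond_risk_integrand.
move=> p; rewrite mule_ge0// lee_fin.
  exact: loss_on_pos_ge0.
exact: (ratio_pdf_ge0 _ _ _ _ _ _ _ sigma2_gt0).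
Qed.

(** As [psi > 0], replacing [L] by [loss_on_pos L] alters the loss at most where [V2 <= 0], a null
    event; the law of the ratio then applies without integrability. *)
Lemma risk_est (psi : R -> R) : measurable_fun setT psi ->
  (forall z, 0 < psi z) ->
  risk P L th (est psi X2 V2) = (\int[lebesgue_measure]_z cond_risk n2 a2 b2 L th psi z)%E.
Proof.
move=> mpsi psi0; have s0 := sigma2_gt0; have [mL _ _ _ _] := bL.
pose g (p : R * R) := (loss_on_pos L (psi p.1 * p.2 / sigma2 th))%:E.
have mg : measurable_fun setT g.
  apply/measurable_EFinP; apply: (measurableT_comp (measurable_loss_on_pos _ _ bL)).
  apply: measurable_funM => //; apply: measurable_funM => //.
  exact: measurableT_comp.
rewrite -(model_ratio_law g)//; last by move=> p; rewrite lee_fin loss_on_pos_ge0.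
have mXV : measurable_fun setT (fun w => (X2 w / V2 w)%R).
  exact: measurable_fun_div.
have mest : measurable_fun setT (fun w => est psi X2 V2 w / sigma2 th).
  apply: measurable_funM => //; apply: measurable_funM => //.
  exact: measurableT_comp.
rewrite /risk unlock; apply: ae_eq_integral => //=.
- by apply/measurable_EFinP; exact: measurableT_comp.
- by apply: measurableT_comp => //; exact: measurable_fun_pair.
exists [set w | V2 w <= 0]; split.
- have := measurable_funPT V2 measurableT `]-oo, 0]%classic (measurable_itv _).
  by rewrite setTI.
- exact: V2_le0_null.
- move=> w /=; apply: contra_notP => /negP; rewrite -ltNge => V0 _.
  by rewrite /g /loss_on_pos /est/= ifT// divr_gt0// mulr_gt0.
Qed.

Lemma cond_riskE (psi : R -> R) (z : R) :
  (forall z, 0 < psi z) -> 0 < z ->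
  diff_under_integral L (ratio_pdf n2 a2 b2 th z) ->
  cond_risk n2 a2 b2 L th psi z = (ratio_loss L n2 a2 b2 th z (psi z / sigma2 th))%:E.
Proof.
move=> psi0 z0 difL; have s0 := sigma2_gt0.
have [|intL _ _] := difL (psi z / sigma2 th); first by rewrite divr_gt0.
rewrite /ratio_loss /Rintegral fineK; last exact: integrable_fin_num.
rewrite [RHS]integral_mkcond; apply: eq_integral => v _; rewrite patchE.
case: ifPn; rewrite ?notin_setE ?inE/= in_itv/= andbT => v0.
  rewrite /loss_on_pos ifT; last by rewrite divr_gt0// mulr_gt0.
  by rewrite -EFinM mulrAC.
rewrite /ratio_pdf gamma_pdf_le0 ?mulr0 ?mul0r ?mule0//.
by rewrite leNgt; exact/negP.
Qed.

End risk_as_ratio_integral.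

(** * Strict comparison of integrals and dominance *)

Lemma lt_ge0_integral (R : realType) (d : measure_display)
    (T : measurableType d) (mu : {measure set T -> \bar R})
    (f g : T -> \bar R) (E : set T) :
  measurable_fun setT f -> measurable_fun setT g ->
  (forall x, 0 <= f x)%E -> (forall x, f x <= g x)%E ->
  (\int[mu]_x f x < +oo)%E ->
  measurable E -> (0 < mu E)%E -> (forall x, E x -> f x < g x)%E ->
  (\int[mu]_x f x < \int[mu]_x g x)%E.
Proof.
move=> mf mg f0 fg intf mE muE fgE.
have g0 x : (0 <= g x)%E by exact: le_trans (fg x).
(* The gap on [E] has positive integral, since otherwise it would vanish almost everywhere and [E]
   would be null. Adding it to the finite integral of [f] gives a strict increase. *)
pose D := (fun x => g x - f x)%E \_ E.
have mD : measurable_fun setT D.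
  apply/(measurable_restrictT _ mE)/measurable_funTS.
  exact: emeasurable_funB.
have D0 x : (0 <= D x)%E.
  by rewrite /D patchE; case: ifPn => // /[!inE] Ex; rewrite ltW// sube_gt0 fgE.
have intD : (0 < \int[mu]_x D x)%E.
  rewrite lt0e integral_ge0// andbT; apply/eqP => D00.
  move: D00; under eq_integral do rewrite -(gee0_abs (D0 _)).
  move=> /(ae_eq_integral_abs mu measurableT mD)[N [mN N0 DN]].
  move: muE; rewrite (_ : mu E = 0) ?ltxx//.
  apply: (subset_measure0 mE mN _ N0) => x Ex; apply: DN => /=. move => /(_ I).
  rewrite /D patchE mem_set// => /eqP; apply/negP.
  by rewrite gt_eqF// sube_gt0 fgE.
apply: (@lt_le_trans _ _ (\int[mu]_x (f x + D x))%E).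
  rewrite ge0_integralD// lteDl// ge0_fin_numE//; exact: integral_ge0.
apply: ge0_le_integral => //.
- by move=> x _; exact: adde_ge0.
- exact: emeasurable_funD.
move=> x _; rewrite /D patchE; case: ifPn => [/[!inE] Ex|_]; last by rewrite adde0.
(* On [E], [f x < g x] forces [f x] to be finite, so the subtraction can be undone. *)
rewrite addeC subeK// ge0_fin_numE//.
exact: lt_le_trans (fgE _ Ex) (leey _).
Qed.

Lemma threshold_gt0 (R : realType) (n a : nat) (beta z : R) :
  0 < beta -> 0 < z -> 0 < threshold n a beta z.
Proof. by move=> b0 z0; rewrite mulr_gt0// ltr_pwDl// mulr_ge0// ltW. Qed.

Lemma measurable_threshold (R : realType) (n a : nat) (beta : R) :
  measurable_fun setT (threshold n a beta).
Proof.
by apply: measurable_funM => //; apply: measurable_funD.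
Qed.

(** Used in contrapositive form: an event on the ratio that has positive probability under one
    parameter has positive Lebesgue measure, a property no longer tied to that parameter. *)
Lemma null_ratio_event (R : realType) (n1 a1 b1 n2 a2 b2 : nat)
    (d : measure_display) (T : measurableType d)
    (P : param R -> probability T R) (X1 X2 V1 V2 : {mfun T >-> R})
    (th : param R) (E : set R) :
  censored_exp_model n1 a1 b1 n2 a2 b2 P X1 X2 V1 V2 -> in_Theta th ->
  measurable E -> lebesgue_measure E = 0 ->
  P th [set w | E (X2 w / V2 w)] = 0.
Proof.
move=> hmodel hth mE E0.
pose g (p : R * R) : \bar R := (\1_E p.1)%:E.
have mg : measurable_fun setT g.
  by apply/measurable_EFinP; apply: measurableT_comp.
have mXV : measurable_fun setT (fun w => (X2 w / V2 w)%R).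
  exact: measurable_fun_div.
have mA : measurable [set w | E (X2 w / V2 w)].
  by have := mXV measurableT E mE; rewrite setTI.
have -> : P th [set w | E (X2 w / V2 w)] =
    (\int[P th]_w g ((X2 w / V2 w)%R, V2 w))%E.
  by rewrite -[X in P th X]setIT -integral_indic.
have g0 p : (0 <= g p)%E by rewrite lee_fin indicE.
rewrite (model_ratio_law hmodel hth)//.
pose F (z : R) := (\int[lebesgue_measure]_v
  (g (z, v) * (ratio_pdf n2 a2 b2 th z v)%:E))%E.
have FE : F = F \_ E.
  apply/funext => z; rewrite patchE; case: ifPn => // zE.
  rewrite /F integral0_eq// => v _.
  by rewrite /g indicE (negbTE zE) mul0e.
rewrite -[LHS]/(\int[lebesgue_measure]_z F z)%E FE -integral_mkcond.
apply: null_set_integral => //; apply: measurable_funTS.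
apply: (@measurable_fun_fubini_tonelli_F _ _ _ _ _ (@lebesgue_measure R)
  (fun p => (g p * (ratio_pdf n2 a2 b2 th p.1 p.2)%:E)%E)).
  apply: emeasurable_funM => //; apply/measurable_EFinP.
  exact: measurable_ratio_pdf.
move=> p; rewrite mule_ge0// lee_fin; exact: (ratio_pdf_ge0 _ _ _ _ _ _ _ (sigma2_gt0 hth)).
Qed.

Theorem theorem3p3 (R : realType) (n1 a1 b1 n2 a2 b2 : nat)
  (ha1 : (1 <= a1)%N) (hab1 : (a1 < b1)%N) (hbn1 : (b1 <= n1)%N)
  (ha2 : (1 <= a2)%N) (hab2 : (a2 < b2)%N) (hbn2 : (b2 <= n2)%N)
  (d : measure_display) (T : measurableType d)
  (P : param R -> probability T R)
  (X1 X2 V1 V2 : {mfun T >-> R})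
  (hmodel : censored_exp_model n1 a1 b1 n2 a2 b2 P X1 X2 V1 V2)
  (L : R -> R) (hL : bowl_loss L)
  (phi : R -> R) (hphi : measurable_fun setT phi)
  (hphi0 : forall z, 0 < phi z)
  (hreg : regular_loss n2 a2 b2 P L (est phi X2 V2))
  (beta : R) (hbeta : is_unique_root (b2 - a2 + 2) L beta)
  (hevent : exists2 th : param R, in_Theta th &
     (0 < P th [set w | (0 < X2 w / V2 w)%R /\
                        (threshold n2 a2 beta (X2 w / V2 w)
                           < phi (X2 w / V2 w))%R])%E) :
  dominates P L (est22 n2 a2 beta phi X2 V2) (est phi X2 V2).
Proof.
have [hrisk + hdiff] := hreg; rewrite addn2 in hbeta *. move=> hint.
have beta0 : 0 < beta by case: hbeta.
(* Merging the two branches presents the truncated estimator as [est phi'], so one risk formula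
   serves both estimators. *)
pose phi' (z : R) := if 0 < z then phi22 n2 a2 beta phi z else phi z.
have mpos : measurable_fun [set: R] (fun z : R => 0 < z).
  exact: measurable_fun_ltr.
have mphi' : measurable_fun setT phi'.
  apply: measurable_fun_ifT => //; apply: measurable_minr => //.
  exact: measurable_threshold.
have phi'0 z : 0 < phi' z.
  rewrite /phi'; case: ifPn => // z0.
  by rewrite lt_min hphi0 threshold_gt0.
have -> : est22 n2 a2 beta phi X2 V2 = est phi' X2 V2.
  by apply/funext => w; rewrite /est22 /est /phi'; case: ifP.
have le_cond th z : in_Theta th ->
    (cond_risk n2 a2 b2 L th phi' z <= cond_risk n2 a2 b2 L th phi z)%E.
  move=> hth; have s0 := sigma2_gt0 hth.
  have [z0|z0] := ltP 0 z; last by rewrite /cond_risk /phi' ltNge z0.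
  have difL := hdiff _ _ hth z0.
  rewrite !cond_riskE// lee_fin /phi' z0 /phi22.
  (* Only where truncation acts is there something to prove; there the smaller constant,
     [threshold / sigma2], lies exactly on the boundary of the monotone region. *)
  have [_|thrphi] := leP (phi z) (threshold n2 a2 beta z); first by [].
  apply: (@le_ratio_loss _ _ _ _ _ _ _ beta) => //.
    by rewrite mulrC divfK// gt_eqF.
  by rewrite ler_pM2r ?invr_gt0// ltW.
split.
  move=> th hth.
  rewrite (risk_est hmodel hL hth _ mphi' phi'0) (risk_est hmodel hL hth _ hphi hphi0).
  apply: ge0_le_integral => //.
  - by move=> z _; exact: cond_risk_ge0.
  - exact: measurable_cond_risk.
  - exact: measurable_cond_risk.
  - by move=> z _; exact: le_cond.
have [th hth Pth] := hevent.
pose th0 := Param (mu1 th) 0 (sigma1 th) (sigma2 th).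
have hth0 : in_Theta th0 by [].
(* At [mu2 = 0] the weight [m] is positive for every [z > 0], which makes the
   conditional expected loss strictly increasing; this may fail at [th] itself. *)
exists th0 => //.
have mthr : measurable_fun setT (fun z => threshold n2 a2 beta z < phi z).
  by apply: measurable_fun_ltr => //; exact: measurable_threshold.
pose E := [set z : R | 0 < z /\ threshold n2 a2 beta z < phi z].
have mE : measurable E.
  have -> : E = [set z : R | 0 < z] `&` [set z | threshold n2 a2 beta z < phi z].
    by [].
  apply: measurableI.
  - have := mpos measurableT [set true] I; rewrite setTI.
    by [].
  - have := mthr measurableT [set true] I; rewrite setTI.
    by [].
(* A strict inequality between the risks requires the smaller one to be finite; it is bounded by
   this one. *)
have risk0 : (risk P L th0 (est phi X2 V2) < +oo)%E.
  rewrite /risk unlock. apply: integrable_lty => //; exact: hrisk.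
move: risk0.
rewrite (risk_est hmodel hL hth0 _ mphi' phi'0) (risk_est hmodel hL hth0 _ hphi hphi0) => risk0.
apply: (@lt_ge0_integral _ _ _ lebesgue_measure _ _ E) => //.
- exact: measurable_cond_risk.
- exact: measurable_cond_risk.
- by move=> z; exact: cond_risk_ge0.
- by move=> z; exact: le_cond.
- apply: le_lt_trans risk0; apply: ge0_le_integral => //.
  + by move=> z _; exact: cond_risk_ge0.
  + exact: measurable_cond_risk.
  + exact: measurable_cond_risk.
  + by move=> z _; exact: le_cond.
(* The event is given positive probability at [th], while the strict inequality is sought at [th0];
   Lebesgue measure of [E] links the two. *)
- rewrite lt0e measure_ge0 andbT; apply: contraTN Pth => /eqP E0.
  by rewrite (@null_ratio_event _ _ _ _ _ _ _ _ _ _ _ _ _ _ _ E hmodel hth mE E0) ltxx.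
- move=> z [z0 thrphi]; have difL := hdiff _ _ hth0 z0.
  have s0 := sigma2_gt0 hth0.
  rewrite !cond_riskE// lte_fin /phi' z0 /phi22 min_r; last exact: ltW.
  apply: (@lt_ratio_loss _ _ _ _ _ _ _ beta) => //.
    by rewrite mulrC divfK// gt_eqF.
  by rewrite ltr_pM2r ?invr_gt0.
Qed.
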